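(* Let $n \geq 1$ be an integer and let $r_n$ be the number of partitions of $2(n-1)$ into powers of $2$ (OEIS sequence A000123). Then $\alpha(\bar C_{2n+1}^{\boxtimes r_n}) \geq 2^{r_n} + 1$, and in particular $\Theta(\bar C_{2n+1}) \geq (2^{r_n}+1)^{1/r_n} = 2 + \Omega(2^{-r_n}/r_n)$.
   Context: All graphs are finite and simple. $C_{2n+1}$ is the cycle on $2n+1$ vertices and $\bar C_{2n+1}$ its complement. $\alpha(G)$ is the independence number of $G$. The strong product $G \boxtimes H$ has vertex set $V(G)\times V(H)$, with distinct vertices $(g,h),(g',h')$ adjacent iff ($g=g'$ or $gg'\in E(G)$) and ($h=h'$ or $hh' \in E(H)$); $G^{\boxtimes k}$ is the $k$-fold strong power. The Shannon capacity is $\Theta(G) = \lim_{k\to\infty}\alpha(G^{\boxtimes k})^{1/k} = \sup_{k \ge 1}\alpha(G^{\boxtimes k})^{1/k}$. The $\Omega$ is as $n \to \infty$. *)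

(* Defs.v *)
From HB Require Import structures.
From mathcomp Require Import all_boot all_order all_algebra.
From mathcomp Require Import all_classical all_reals all_analysis.
Import Order.TTheory GRing.Theory Num.Theory.

Set Implicit Arguments.
Unset Strict Implicit.
Unset Printing Implicit Defensive.

Record sgraph := SGraph {
  vertex :> finType;
  adj : rel vertex;
  adj_sym : symmetric adj;
  adj_irr : irreflexive adj }.

Definition independent (G : sgraph) (S : {set G}) : bool :=
  [forall x in S, forall y in S, ~~ adj x y].

Definition alpha (G : sgraph) : nat :=
  \max_(S : {set G} | independent S) #|S|.

Section Cycle.
Variable m : nat.

(* The conjunct i != j only matters for the degenerate case m = 1. *)
Definition cycle_adj : rel 'I_m := fun i j =>
  (i != j) && ((j == i.+1 %[mod m]) || (i == j.+1 %[mod m])).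

Lemma cycle_adj_sym : symmetric cycle_adj.
Proof. by move=> i j; rewrite /cycle_adj eq_sym orbC. Qed.

Lemma cycle_adj_irr : irreflexive cycle_adj.
Proof. by move=> i; rewrite /cycle_adj eqxx. Qed.

Definition cycle_graph : sgraph := SGraph cycle_adj_sym cycle_adj_irr.

End Cycle.

Section Complement.
Variable G : sgraph.

Definition compl_adj : rel G := fun x y => (x != y) && ~~ adj x y.

Lemma compl_adj_sym : symmetric compl_adj.
Proof. by move=> x y; rewrite /compl_adj eq_sym adj_sym. Qed.

Lemma compl_adj_irr : irreflexive compl_adj.
Proof. by move=> x; rewrite /compl_adj eqxx. Qed.

Definition compl_graph : sgraph := SGraph compl_adj_sym compl_adj_irr.

End Complement.

Section StrongProduct.
Variables G H : sgraph.

Definition strong_adj : rel (G * H)%type := fun u v =>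
  [&& u != v, (u.1 == v.1) || adj u.1 v.1 & (u.2 == v.2) || adj u.2 v.2].

Lemma strong_adj_sym : symmetric strong_adj.
Proof.
move=> u v; rewrite /strong_adj eq_sym (eq_sym u.1) (eq_sym u.2).
by rewrite (adj_sym u.1) (adj_sym u.2).
Qed.

Lemma strong_adj_irr : irreflexive strong_adj.
Proof. by move=> u; rewrite /strong_adj eqxx. Qed.

Definition strong_prod : sgraph := SGraph strong_adj_sym strong_adj_irr.

End StrongProduct.

Definition one_vertex_graph : sgraph :=
  @SGraph unit (fun _ _ => false) (fun _ _ => erefl) (fun _ => erefl).

Fixpoint strong_power (G : sgraph) (k : nat) : sgraph :=
  if k is k'.+1 then strong_prod G (strong_power G k') else one_vertex_graph.

(* A partition of m is a multiset of positive integers with sum m, encoded by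
   its multiplicity function f: the part i occurs f i times. Both the parts and
   their multiplicities are at most m. The part 0 never occurs, since 0 is not
   a power of 2. *)
Definition pow2 (i : nat) : bool := [exists k : 'I_i.+1, i == 2 ^ k].

Definition binary_partitions (m : nat) : {set {ffun 'I_m.+1 -> 'I_m.+1}} :=
  [set f : {ffun 'I_m.+1 -> 'I_m.+1} |
    [forall i, (0 < f i) ==> pow2 i] && (\sum_i f i * i == m)].

Definition r_ (n : nat) : nat := #|binary_partitions (2 * (n - 1))|.

Local Open Scope ring_scope.
Local Open Scope classical_set_scope.

(* The supremum is over a nonempty set bounded by the number of vertices; by
   Fekete's lemma it is also the limit of the sequence. *)
Definition shannon_capacity (R : realType) (G : sgraph) : R :=
  sup [set (alpha (strong_power G k))%:R `^ (k%:R^-1) | k in [set k | (1 <= k)%N]].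

(* Main.v *)
Require Import Defs.
From mathcomp Require Import all_boot all_order all_algebra.
From mathcomp Require Import all_classical all_reals all_analysis.
From mathcomp Require Import zify ring lra.
Import Order.TTheory GRing.Theory Num.Theory.

(* Give the vertices of C_(2N+1) the labels 0, 1, ..., 2N in cyclic order. An
   independent set of size 2^r + 1 in a product of complements of the cycles
   C_(2N_i+1), i < r, arises from 2^r words with letters in 1, ..., 2N_i such
   that any two words have consecutive letters at some coordinate and every
   word has a letter 1 or 2N_i at some coordinate i: add the word 0...0.
   Splitting a coordinate c of such a code gives two copies of every word w,
   indexed by a bit b: the letter w_c becomes w_c + 2b, and a new letter
   1 + b + 2(2N_c - w_c) is appended. The result is again a code, with one more
   coordinate, where N_c has become N_c + 1 and the new parameter is 2N_c.
   Starting from one coordinate with N = 1 and splitting while some parameter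
   is below n, the final number of coordinates is the number of leaves of the
   tree m -> {m + 1, 2m} rooted at 1 and cut at n. This number and r_n satisfy
   the same recursion u_n = u_(n-1) + u_(ceil(n/2)). *)

Set Implicit Arguments.
Unset Strict Implicit.
Unset Printing Implicit Defensive.

(** * Path codes and the splitting of a coordinate *)

Definition consecutive (u v : nat) : bool := (u == v.+1) || (v == u.+1).

Definition path_code (r : nat) (N : nat -> nat) (w : nat -> nat -> nat) : Prop :=
  [/\ forall x i, x < 2 ^ r -> i < r -> 0 < w x i <= 2 * N i,
      forall x, x < 2 ^ r ->
        exists2 i, i < r & (w x i == 1) || (w x i == 2 * N i)
    & forall x y, x < 2 ^ r -> y < 2 ^ r -> x != y ->
        exists2 i, i < r & consecutive (w x i) (w y i)].

Lemma path_code_split r N w c :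
  path_code r N w -> c < r ->
  path_code r.+1
    (fun i => if i == c then (N c).+1 else if i == r then 2 * N c else N i)
    (fun x i => if i == c then w x./2 c + 2 * odd x
                else if i == r then 1 + odd x + 2 * (2 * N c - w x./2 c)
                else w x./2 i).
Proof.
move=> [bnd endp sep] cr.
have half_lt x : x < 2 ^ r.+1 -> x./2 < 2 ^ r by rewrite expnS; lia.
have rc : (r == c) = false by rewrite gtn_eqF.
split=> [x i /half_lt xr ir|x /half_lt xr|x y xr1 yr1 xy].
- have bc := bnd _ _ xr cr.
  have [_|_] := eqVneq i c; first by lia.
  have [_|ir'] := eqVneq i r; first by lia.
  by apply: (bnd _ _ xr); lia.
- have [i ir] := endp _ xr; have := bnd _ _ xr cr.
  have [-> bc wc|ic _ wi] := eqVneq i c; last first.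
    by exists i; rewrite ?(negbTE ic) ?(ltn_eqF ir) //; lia.
  (* A letter 1 with bit 0 and a letter [2 * N c] with bit 1 stay ends at [c]; with the opposite
     bits the appended letter becomes [2 * (2 * N c)] and 1, respectively. *)
  have [w1|w1] := eqVneq (w x./2 c) 1; case: (boolP (odd x)) => xo.
  + by exists r; rewrite // rc eqxx; lia.
  + by exists c; [lia | rewrite eqxx; lia].
  + by exists c; [lia | rewrite eqxx; lia].
  + by exists r; rewrite // rc eqxx; lia.
have [xr yr] := (half_lt _ xr1, half_lt _ yr1).
have [e|ne] := eqVneq x./2 y./2.
  by exists r => //; rewrite rc eqxx e /consecutive; lia.
have [i ir s] := sep _ _ xr yr ne.
have bx := bnd _ _ xr cr; have by_ := bnd _ _ yr cr.
have [ic|ic] := eqVneq i c; last first.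
  by exists i; [exact: ltnW | rewrite (negbTE ic) (ltn_eqF ir)].
move: s; rewrite ic => s.
have [t|t] := boolP (consecutive (w x./2 c + 2 * odd x) (w y./2 c + 2 * odd y)).
  by exists c; [exact: ltnW | rewrite eqxx].
(* What remains is [v] with bit 0 against [v + 1] with bit 1, moved to distance 3 at [c]; their
   appended letters are [4 * N c - 2 * v + 1] and [4 * N c - 2 * v]. *)
exists r => //; rewrite rc eqxx.
by move: s t; rewrite /consecutive; lia.
Qed.

(** * Leaf counts and repeated splitting *)

(* [1 + extra_leaves m n] is the number of leaves of the tree m -> {m + 1, 2m} rooted
   at [m] and cut at [n]. The recursion is on [n] rather than along the tree, in
   order to match the recursion of [r_]; [f] is fuel. *)
Fixpoint extra_leaves_rec (f m n : nat) : nat :=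
  if f is f'.+1 then
    if n <= 1 then 0
    else (m < n) + extra_leaves_rec f' m n.-1 + extra_leaves_rec f' m (uphalf n)
  else 0.

Definition extra_leaves (m n : nat) : nat := extra_leaves_rec n m n.

Lemma extra_leaves_rec_fuel f g m n :
  n <= f -> n <= g -> extra_leaves_rec f m n = extra_leaves_rec g m n.
Proof.
elim: f g n => [|f IH] [|g] [|n] //= nf ng.
by case: ifP => // n1; congr (_ + _ + _); apply: IH; lia.
Qed.

Lemma extra_leavesE m n : 1 < n ->
  extra_leaves m n = (m < n) + extra_leaves m n.-1 + extra_leaves m (uphalf n).
Proof.
case: n => [|[|n]] // _.
rewrite {3}/extra_leaves (@extra_leaves_rec_fuel _ n.+1) //=; lia.
Qed.

(** The recursions in [n] and along the tree commute, because [m < n.-1] iff [m.+1 < n], and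
    [m < uphalf n] iff [2 * m < n]. *)
Lemma extra_leaves_split m n : 0 < m ->
  extra_leaves m n = (m < n) + extra_leaves m.+1 n + extra_leaves (2 * m) n.
Proof.
move=> m0; elim/ltn_ind: n => [[|[|n]] IH].
- by rewrite /extra_leaves /=; lia.
- by rewrite /extra_leaves /=; lia.
rewrite !(@extra_leavesE _ n.+2) // (IH n.+1) // (IH (uphalf n.+2)); last by rewrite /=; lia.
by rewrite /=; lia.
Qed.

Lemma extra_leaves_eq0 m n : n <= m -> extra_leaves m n = 0.
Proof.
elim/ltn_ind: n => [[|[|n]]] IH // nm.
rewrite extra_leavesE // !IH //; rewrite /=; lia.
Qed.

(** Here [k] counts the splits still to be made: splitting a coordinate with [N c < n] lowers the
    sum by exactly one. *)
Lemma path_code_stretch n k r N w : 0 < n ->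
  path_code r N w -> (forall i, i < r -> 0 < N i) ->
  \sum_(i < r) extra_leaves (N i) n = k ->
  exists N' w', path_code (r + k) N' w' /\ forall i, i < r + k -> n <= N' i.
Proof.
move=> n0; elim: k r N w => [|k IH] r N w code N0 sumk.
  exists N, w; rewrite addn0; split=> // i ir.
  move/eqP: sumk; rewrite sum_nat_eq0 => /forallP /(_ (Ordinal ir)) /=.
  (* A parameter [N i] below [n] would make its summand positive. *)
  have := @extra_leaves_split (N i) n (N0 i ir); lia.
have [c cn] : exists c : 'I_r, N c < n.
  apply/existsP; apply: contra_eqT sumk => /existsPn big.
  by rewrite big1 // => i _; apply: extra_leaves_eq0; rewrite leqNgt big.
have := IH _ _ _ (path_code_split code (ltn_ord c)).
rewrite addSnnS; apply.
  move=> i ir; case: ifP => // _; have := N0 _ (ltn_ord c).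
  by case: ifP => [_|ir' _]; [lia | apply: N0; lia].
rewrite big_ord_recr /= eqxx gtn_eqF ?ltn_ord //.
move: sumk; rewrite (bigD1 c) //= extra_leaves_split ?N0 // cn => sumk.
rewrite (bigD1 c) //= eqxx.
under eq_bigr => i ic do rewrite -[val i == val c]/(i == c) (negbTE ic) ltn_eqF //.
move: sumk; lia.
Qed.

(** * Binary partitions as functions on the naturals *)

Lemma pow2P i : reflect (exists k, i = 2 ^ k) (pow2 i).
Proof.
apply: (iffP existsP) => [[k /eqP ->]|[k ik]]; first by exists k.
have ki : k < i.+1 by rewrite ik ltnS ltnW // ltn_expl.
by exists (Ordinal ki); apply/eqP.
Qed.

Lemma pow2_double i : pow2 (2 * i) = pow2 i.
Proof.
apply/pow2P/pow2P => [[[|k]]|[k ->]]; last by exists k.+1; rewrite expnS.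
  by rewrite expn0; lia.
by rewrite expnS => /eqP; rewrite eqn_mul2l /= => /eqP ->; exists k.
Qed.

Lemma pow2_odd i : odd i -> pow2 i -> i = 1.
Proof. by move=> oi /pow2P [[|k] ik]; move: oi; rewrite ik // oddX. Qed.

(* The sum condition for all large [K] makes the support of [g] lie below [m.+1],
   so that one type of functions serves all values of [m]. *)
Definition binary_partition (m : nat) (g : nat -> nat) : Prop :=
  (forall i, 0 < g i -> pow2 i) /\ (forall K, m < K -> \sum_(i < K) g i * i = m).

Definition multiplicity m (f : {ffun 'I_m.+1 -> 'I_m.+1}) (i : nat) : nat :=
  if i <= m then nat_of_ord (f (inord i)) else 0.

Definition truncated m (g : nat -> nat) : {ffun 'I_m.+1 -> 'I_m.+1} :=
  [ffun i : 'I_m.+1 => inord (g i)].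

Lemma multiplicityP m (f : {ffun 'I_m.+1 -> 'I_m.+1}) :
  f \in binary_partitions m -> binary_partition m (multiplicity f).
Proof.
rewrite inE => /andP [/forallP f2 /eqP fm]; split=> [i|K mK].
  rewrite /multiplicity; case: ifP => // im fi.
  by have := f2 (inord i); rewrite fi inordK.
rewrite -[RHS]fm -(big_mkord xpredT (fun i => multiplicity f i * i)).
rewrite (big_cat_nat (n := m.+1)) //= big_mkord [X in _ + X]big_nat.
rewrite [X in _ + X]big1 ?addn0 => [|i /andP [mi _]]; last first.
  by rewrite /multiplicity leqNgt mi.
by apply: eq_bigr => i _; rewrite /multiplicity -ltnS ltn_ord inord_val.
Qed.

(** Ensures that the [inord] in [truncated] loses nothing. *)
Lemma binary_partition_bound m g i :
  binary_partition m g -> 0 < g i -> (g i <= m) && (i <= m).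
Proof.
move=> [g2 gm] gi.
have i0 : 0 < i by have /pow2P [k ->] := g2 _ gi; rewrite expn_gt0.
have mK : m < maxn m i + 1 by lia.
have iK : i < maxn m i + 1 by lia.
have := gm _ mK; rewrite (bigD1 (Ordinal iK)) //=; nia.
Qed.

Lemma truncatedK m g :
  binary_partition m g -> multiplicity (truncated m g) = g.
Proof.
move=> gm; apply/funext => i; rewrite /multiplicity /truncated.
have [g0|/(binary_partition_bound gm)/andP [gi im]] := posnP (g i).
  by case: ifP => // im; rewrite ffunE (@inordK _ i) // g0 inordK.
by rewrite im ffunE (@inordK _ i) // inordK.
Qed.

Lemma truncated_in m g :
  binary_partition m g -> truncated m g \in binary_partitions m.
Proof.
move=> gm; have := gm => -[g2 gsum]; rewrite inE.
have tE (i : 'I_m.+1) : truncated m g i = g i :> nat.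
  by rewrite -{2}(truncatedK gm) /multiplicity -ltnS ltn_ord inord_val.
apply/andP; split; first by apply/forallP => i; apply/implyP; rewrite tE; exact: g2.
by apply/eqP; rewrite -[RHS](gsum m.+1) //; apply: eq_bigr => i _; rewrite tE.
Qed.

Lemma multiplicity_inj m : injective (@multiplicity m).
Proof.
move=> f g /funeqP fg; apply/ffunP => i; apply/val_inj.
by have := fg i; rewrite /multiplicity -ltnS ltn_ord inord_val.
Qed.

(** * The recursion for the number of binary partitions *)

Definition partition_count (m : nat) (P : pred (nat -> nat)) : nat :=
  #|[set f in binary_partitions m | P (multiplicity f)]|.

(** Applied in both directions, this turns a bijection of partitions into an equality of counts,
    away from the finite types. *)
Lemma partition_count_le m m' (P P' : pred (nat -> nat))
    (F G : (nat -> nat) -> (nat -> nat)) :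
  (forall g, binary_partition m g -> P g ->
     [/\ binary_partition m' (F g), P' (F g) & G (F g) = g]) ->
  partition_count m P <= partition_count m' P'.
Proof.
move=> FG; pose h (f : {ffun 'I_m.+1 -> 'I_m.+1}) := truncated m' (F (multiplicity f)).
have hK : {in [set f in binary_partitions m | P (multiplicity f)] &,
    injective h}.
  move=> f g; rewrite inE => /andP [/multiplicityP fm Pf].
  rewrite inE => /andP [/multiplicityP gm Pg] /(congr1 (@multiplicity m')).
  have [Ff _ Kf] := FG _ fm Pf; have [Fg _ Kg] := FG _ gm Pg.
  by rewrite !truncatedK // => /(congr1 G); rewrite Kf Kg => /multiplicity_inj.
rewrite /partition_count -(card_in_imset hK); apply/subset_leq_card/fintype.subsetP.
move=> y /imsetP [f]; rewrite inE => /andP [/multiplicityP fm Pf] ->{y}.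
have [Ff P'f _] := FG _ fm Pf.
by rewrite inE truncated_in //= truncatedK.
Qed.

Lemma card_binary_partitions m : #|binary_partitions m| = partition_count m xpredT.
Proof. by apply: eq_card => f; rewrite !inE andbT. Qed.

Lemma partition_count_split m (P : pred (nat -> nat)) :
  #|binary_partitions m| = partition_count m P + partition_count m (predC P).
Proof.
rewrite -(cardsID [set f | P (multiplicity f)]).
by congr (_ + _); apply: eq_card => f; rewrite !inE // andbC.
Qed.

Lemma partition_count_with_one m :
  partition_count m.+1 (fun g => 0 < g 1) = #|binary_partitions m|.
Proof.
rewrite card_binary_partitions.
pose dec (g : nat -> nat) i := g i - (i == 1).
pose inc (g : nat -> nat) i := g i + (i == 1).
have sum_inc K g : 1 < K -> \sum_(i < K) inc g i * i = (\sum_(i < K) g i * i).+1.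
  move=> K1; under eq_bigr do rewrite mulnDl.
  rewrite big_split /= -[RHS]addn1; congr (_ + _).
  rewrite (bigD1 (Ordinal K1)) //= big1 // => i.
  by rewrite -val_eqE /= => /negbTE ->.
apply/anti_leq/andP; split.
  apply: (@partition_count_le _ _ _ _ dec inc) => g [g2 gsum] g1.
  have decK : inc (dec g) = g.
    by apply/funext => i; rewrite /inc /dec subnK //; case: eqP => // ->.
  have dsum K : m.+1 < K -> \sum_(i < K) dec g i * i = m.
    by move=> mK; apply/succn_inj; rewrite -sum_inc ?decK ?gsum //; lia.
  split=> //; split=> [i di|K mK]; first by apply: g2; move: di; rewrite /dec; lia.
  (* Only [K = m.+1] is not covered by [dsum]; the term at [m.+1] is a multiple of [m.+1] within a
     sum equal to [m], hence zero. *)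
  have [/dsum //|Km] := ltnP m.+1 K.
  have := dsum m.+2 (ltnSn _); rewrite big_ord_recr /=.
  have -> : K = m.+1 by lia.
  by case: (dec g m.+1) => [|d]; nia.
apply: (@partition_count_le _ _ _ _ inc dec) => g [g2 gsum] _.
have incK : dec (inc g) = g by apply/funext => i; rewrite /inc /dec addnK.
split=> //; last by rewrite /inc addn1.
split=> [i|K mK]; last by rewrite sum_inc ?gsum //; lia.
rewrite /inc; have [-> _|_] := eqVneq i 1; first by apply/pow2P; exists 0.
by rewrite addn0; exact: g2.
Qed.

Lemma sum_even_support K (g : nat -> nat) :
  \sum_(i < K) (if odd i then 0 else g i./2) * i = 2 * \sum_(i < uphalf K) g i * i.
Proof.
elim: K => [|K IH]; first by rewrite !big_ord0.
rewrite big_ord_recr /= IH; have [Ko|Ke] := boolP (odd K).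
  by rewrite uphalf_half Ko add1n mul0n addn0.
by rewrite uphalf_half (negbTE Ke) add0n big_ord_recr /= mulnDr; nia.
Qed.

(** Without the part 1 all parts are even and can be halved. *)
Lemma partition_count_without_one m :
  partition_count (2 * m) (predC (fun g => 0 < g 1)) = #|binary_partitions m|.
Proof.
rewrite card_binary_partitions.
pose halve (g : nat -> nat) i := g (2 * i).
pose double (g : nat -> nat) i := if odd i then 0 else g i./2.
apply/anti_leq/andP; split.
  apply: (@partition_count_le _ _ _ _ halve double) => g [g2 gsum] g1.
  have halveK : double (halve g) = g.
    apply/funext => i; rewrite /double /halve; have [oi|ei] := boolP (odd i).
      have [//|/g2 /(pow2_odd oi) i1] := posnP (g i).
      by move: g1; rewrite i1 /= -eqn0Ngt => /eqP.
    by congr g; lia.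
  split=> //; split=> [i|K mK]; first by move=> /g2; rewrite pow2_double.
  have : \sum_(i < 2 * K) double (halve g) i * i = _ := sum_even_support _ _.
  rewrite halveK.
  have -> : uphalf (2 * K) = K by lia.
  by rewrite gsum; lia.
apply: (@partition_count_le _ _ _ _ double halve) => g [g2 gsum] _.
have doubleK : halve (double g) = g.
  by apply/funext => i; rewrite /halve /double oddM /=; congr g; lia.
split=> //; split=> [i|K mK].
  rewrite /double; case: ifP => // /negbT ei /g2.
  by rewrite -pow2_double; congr pow2; lia.
by rewrite sum_even_support gsum //; lia.
Qed.

Lemma partition_count_odd m :
  partition_count (2 * m).+1 (predC (fun g => 0 < g 1)) = 0.
Proof.
apply/eqP; rewrite cards_eq0; apply/eqP/finset.setP => f; rewrite inE [RHS]inE.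
apply/negbTE/negP => /andP [/multiplicityP []].
set g := multiplicity f => g2 gsum /= g1.
suff : ~~ odd (\sum_(i < (2 * m).+2) g i * i) by rewrite gsum //; lia.
elim/big_ind: _ => // [x y|i _]; first by rewrite oddD; do 2![case: odd].
rewrite oddM; have [oi|] := boolP (odd i); last by rewrite andbF.
have [->//|/g2 /(pow2_odd oi) ->] := posnP (g i).
by move: g1; case: (g 1).
Qed.

Lemma card_binary_partitions_odd m :
  #|binary_partitions (2 * m).+1| = #|binary_partitions (2 * m)|.
Proof.
by rewrite (partition_count_split _ (fun g => 0 < g 1)) partition_count_with_one
  partition_count_odd addn0.
Qed.

Lemma card_binary_partitions_even m :
  #|binary_partitions (2 * m.+1)| =
  #|binary_partitions (2 * m).+1| + #|binary_partitions m.+1|.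
Proof.
rewrite (partition_count_split _ (fun g => 0 < g 1)) partition_count_without_one.
by rewrite mulnS partition_count_with_one.
Qed.

Lemma r_1 : r_ 1 = 1.
Proof.
rewrite /r_ muln0; apply/eqP; rewrite eqn_leq; apply/andP; split.
  by rewrite (leq_trans (max_card _)) // card_ffun !card_ord.
apply/card_gt0P; exists [ffun=> ord0]; rewrite inE; apply/andP; split.
  by apply/forallP => i; rewrite ffunE.
by rewrite big1 // => i _; rewrite ffunE.
Qed.

(** The last summand counts the partitions of [n.-1]: an odd [n.-1] may be lowered by one, to
    [2 * (uphalf n - 1)]. *)
Lemma r_rec n : 1 < n -> r_ n = r_ n.-1 + r_ (uphalf n).
Proof.
case: n => [|[|n]] // _; rewrite /r_ !subn1 /= card_binary_partitions_even.
rewrite card_binary_partitions_odd; congr (_ + _).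
have [no|ne] := boolP (odd n).
  by rewrite (_ : n.+1 = 2 * uphalf n) //; lia.
rewrite (_ : n.+1 = (2 * n./2).+1); last by lia.
rewrite card_binary_partitions_odd (_ : uphalf n = n./2) //; lia.
Qed.

(** * From path codes to independent sets in strong powers *)

Fixpoint power_vertex (G : sgraph) (k : nat) (f : nat -> G) : strong_power G k :=
  if k is k'.+1 then (f k', power_vertex k' f) else tt.

Lemma power_vertex_separated (G : sgraph) k (f g : nat -> G) i :
  i < k -> f i != g i -> ~~ adj (f i) (g i) ->
  (power_vertex k f != power_vertex k g) &&
  ~~ adj (power_vertex k f) (power_vertex k g).
Proof.
elim: k => // k IH; rewrite ltnS leq_eqVlt => /predU1P [-> fg nadj|ik fg nadj].
  by rewrite /= /strong_adj xpair_eqE /= (negbTE fg) (negbTE nadj).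
have /andP [neq nadjk] := IH ik fg nadj.
by rewrite /= /strong_adj xpair_eqE /= (negbTE neq) (negbTE nadjk) /= !andbF.
Qed.

Lemma card_strong_power (G : sgraph) k : #|strong_power G k| = #|G| ^ k.
Proof.
elim: k => [|k IH]; first by rewrite /= card_unit.
by rewrite /= card_prod expnS IH.
Qed.

Lemma alpha_ge (G : sgraph) m (f : 'I_m -> G) :
  (forall x y, x != y -> (f x != f y) && ~~ adj (f x) (f y)) -> m <= alpha G.
Proof.
move=> sep.
have f_inj : injective f.
  by move=> x y fxy; apply/eqP; apply: contraT => /sep; rewrite fxy eqxx.
have ind : independent [set f x | x : 'I_m].
  apply/forall_inP => _ /imsetP [x _ ->]; apply/forall_inP => _ /imsetP [y _ ->].
  have [->|/sep /andP [] //] := eqVneq x y; by rewrite adj_irr.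
by rewrite -{1}(card_ord m) -(card_imset _ f_inj); apply: leq_bigmax_cond.
Qed.

Lemma alpha_le_card (G : sgraph) : alpha G <= #|G|.
Proof. by apply/bigmax_leqP => S _; apply: max_card. Qed.

Lemma power_code_alpha (G : sgraph) m k (f : 'I_m -> nat -> G) :
  (forall x y, x != y ->
     exists2 i, i < k & (f x i != f y i) && ~~ adj (f x i) (f y i)) ->
  m <= alpha (strong_power G k).
Proof.
move=> sep; apply: (@alpha_ge _ _ (fun x => power_vertex k (f x))) => x y.
by case/sep => i ik /andP []; apply: power_vertex_separated.
Qed.

Lemma cycle_adj_consecutive m (i j : 'I_m.+1) : 1 < m ->
  consecutive i j || (i == m :> nat) && (j == 0 :> nat) -> cycle_adj i j.
Proof.
move=> m1; rewrite /cycle_adj -val_eqE /=.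
case/orP => [/orP [/eqP ->|/eqP ->]|/andP [/eqP -> /eqP ->]].
- by rewrite eqxx orbT andbT; lia.
- by rewrite eqxx andbT; lia.
- by rewrite modnn mod0n eqxx andbT; lia.
Qed.

(* Winds the labels beyond [2 * n] back onto the edge between [2 * n - 1] and
   [2 * n], so that even endpoints land on [2 * n]. *)
Definition folded (n v : nat) : nat := if v <= 2 * n then v else 2 * n - odd v.

Lemma folded_consecutive n u v : 0 < n ->
  consecutive u v -> consecutive (folded n u) (folded n v).
Proof.
move=> n0; rewrite /consecutive /folded.
case: (leqP u (2 * n)) => ?; case: (leqP v (2 * n)) => ?;
  by case/orP => /eqP uv; subst; lia.
Qed.

(** Folding brings all coordinates to one cycle and leaves end letters on 1 and [2 * n], the
    neighbours of 0. A coordinate with letters adjacent in the cycle separates two words in the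
    power of the complement. *)
Lemma path_code_alpha n r N w : 0 < n ->
  path_code r N w -> (forall i, i < r -> n <= N i) ->
  2 ^ r + 1 <= alpha (strong_power (compl_graph (cycle_graph (2 * n + 1))) r).
Proof.
move=> n0 [_ endp sep] Nn; rewrite !addn1.
(* The extra index [2 ^ r] carries the added word, constantly 0. *)
pose label x i := if x < 2 ^ r then folded n (w x i) else 0.
pose c (x : 'I_(2 ^ r).+1) i : 'I_(2 * n).+1 := inord (label x i).
have cE x i : c x i = label x i :> nat.
  rewrite /c inordK // /label /folded; case: ifP => // _.
  by case: ifP => // _; rewrite ltnS leq_subr.
have adjc (x y : 'I_(2 ^ r).+1) : x < y -> exists2 i, i < r & cycle_adj (c x i) (c y i).
  move=> xy; have xr : x < 2 ^ r by rewrite (leq_trans xy) // -ltnS.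
  have [yr|yr] := ltnP y (2 ^ r).
    have [|i ir s] := sep _ _ xr yr; first by rewrite ltn_eqF.
    exists i => //; apply: cycle_adj_consecutive; first by lia.
    by rewrite !cE /label xr yr folded_consecutive.
  have [i ir e] := endp _ xr; exists i => //; have Ni := Nn _ ir.
  have labels : (label x i == 1) || (label x i == 2 * n).
    by rewrite /label xr /folded; case/orP: e => /eqP ->; case: leqP; lia.
  have y0 : label y i = 0 by rewrite /label ltnNge yr.
  case/orP: labels => /eqP li; apply: cycle_adj_consecutive;
    rewrite ?cE ?li ?y0 ?eqxx ?orbT //; lia.
apply: (@power_code_alpha (compl_graph (cycle_graph (2 * n).+1)) _ _ c) => x y xy.
have [i ir cxy] : exists2 i, i < r & cycle_adj (c x i) (c y i).
  case: (ltngtP x y) => [/adjc //|/adjc [i ir]|/val_inj exy].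
    by rewrite cycle_adj_sym; exists i.
  by rewrite exy eqxx in xy.
exists i => //; have /andP [neq _] := cxy.
by rewrite neq /= /compl_adj /= cxy andbF.
Qed.

(** The recursions agree: the term [1 < n] supplies the 1 of the second summand. *)
Lemma r_extra_leaves n : 0 < n -> r_ n = 1 + extra_leaves 1 n.
Proof.
elim/ltn_ind: n => [[|[|n]]] IH // _; first by rewrite r_1.
rewrite r_rec // extra_leavesE // (IH n.+1) // (IH (uphalf n.+2)) //=; lia.
Qed.

Lemma alpha_compl_odd_cycle n : 0 < n ->
  2 ^ r_ n + 1 <= alpha (strong_power (compl_graph (cycle_graph (2 * n + 1))) (r_ n)).
Proof.
move=> n0.
(* The two one-letter words 1 and 2. *)
have code1 : path_code 1 (fun=> 1) (fun x _ => x.+1).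
  split=> [x i x2 _|x x2|x y x2 y2 xy]; first by lia.
    by exists 0 => //; lia.
  by exists 0 => //; rewrite /consecutive; lia.
have [N [w [code Nn]]] := path_code_stretch n0 code1 (fun _ _ => isT) (erefl _).
rewrite big_ord_recl big_ord0 addn0 -r_extra_leaves // in code Nn.
exact: path_code_alpha code Nn.
Qed.

(** * Shannon capacity and the asymptotic bound *)

Local Open Scope ring_scope.
Local Open Scope classical_set_scope.

Lemma exprnK_powR (R : realType) (x : R) k : (0 < k)%N -> 0 <= x ->
  (x ^+ k) `^ (k%:R^-1) = x.
Proof.
by move=> k0 x0; rewrite -powR_mulrn // -powRrM divff ?powRr1 // pnatr_eq0 -lt0n.
Qed.

Lemma ler_root (R : realType) (x y : R) k : 0 <= x -> x <= y ->
  x `^ (k%:R^-1) <= y `^ (k%:R^-1).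
Proof.
move=> x0 xy; apply: ge0_ler_powR => //; rewrite ?nnegrE ?invr_ge0 //.
exact: le_trans xy.
Qed.

Lemma root_alpha_le_capacity (R : realType) (G : sgraph) k : (0 < k)%N ->
  (alpha (strong_power G k))%:R `^ (k%:R^-1) <= shannon_capacity R G.
Proof.
move=> k0; apply: ub_le_sup; last by exists k.
exists #|G|%:R => _ [j /= j0 <-].
rewrite -[leRHS](@exprnK_powR _ _ j) // ler_root // -natrX ler_nat -card_strong_power.
exact: alpha_le_card.
Qed.

(** This is [(1 + y)^k <= 1 / (1 - k y)] cleared of its denominator, so that no sign condition on
    [1 - k y] arises. *)
Lemma bernoulli_upper (R : realType) (y : R) k : 0 <= y ->
  (1 + y) ^+ k * (1 - k%:R * y) <= 1.
Proof.
move=> y0; elim: k => [|k IH]; first by rewrite expr0 mul0r subr0 mulr1.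
apply: le_trans IH; rewrite exprSr -mulrA ler_wpM2l ?exprn_ge0 //; first by lra.
have k0 : 0 <= k%:R :> R by [].
rewrite -natr1; nra.
Qed.

(** With [a = 2^-k] and [y = a / (2k)], [bernoulli_upper] gives
    [(1 + y)^k <= 1 / (1 - a/2) <= 1 + a], the last step by [a <= 1]. *)
Lemma root_pow2_add1_ge (R : realType) k : (0 < k)%N ->
  2 + 2 ^- k / k%:R <= (2 ^+ k + 1 : R) `^ (k%:R^-1).
Proof.
move=> k0; have k0' : 0 < k%:R :> R by rewrite ltr0n.
set a : R := 2 ^- k.
have a0 : 0 < a by rewrite invr_gt0 exprn_gt0.
have a1 : a <= 1 by rewrite invf_le1 ?exprn_gt0 // exprn_ege1 // ler1n.
have ak0 : 0 <= a / k%:R by rewrite divr_ge0 // ltW.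
rewrite -[leLHS](@exprnK_powR _ _ k) //; last by lra.
apply: ler_root; first by rewrite exprn_ge0 //; lra.
have -> : 2 + a / k%:R = 2 * (1 + a / k%:R / 2) by field; rewrite gt_eqF.
have -> : 2 ^+ k + 1 = 2 ^+ k * (1 + a).
  by rewrite mulrDr mulr1 divff // expf_neq0.
rewrite exprMn ler_wpM2l ?exprn_ge0 //.
have y0 : 0 <= a / k%:R / 2 by lra.
have := bernoulli_upper k y0; set t := (1 + _) ^+ k.
have -> : k%:R * (a / k%:R / 2) = a / 2 by field; rewrite gt_eqF.
move=> B.
have t0 : 0 <= t by rewrite exprn_ge0 //; lra.
have : t * (1 - a / 2) <= (1 + a) * (1 - a / 2) by nra.
by rewrite ler_pM2r //; lra.
Qed.

Theorem theorem1p1 (R : realType) :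
  (forall n : nat, (1 <= n)%N ->
     let G := compl_graph (cycle_graph (2 * n + 1)) in
     (2 ^ r_ n + 1 <= alpha (strong_power G (r_ n)))%N /\
     (2 ^+ r_ n + 1 : R) `^ ((r_ n)%:R^-1) <= shannon_capacity R G) /\
  (exists2 c : R, 0 < c &
     \forall n \near \oo,
       2 + c * (2 ^- r_ n / (r_ n)%:R) <= (2 ^+ r_ n + 1 : R) `^ ((r_ n)%:R^-1)).
Proof.
have r_gt0 n : (1 <= n)%N -> (0 < r_ n)%N by move=> /r_extra_leaves ->.
split=> [n n1 G|].
  have code := alpha_compl_odd_cycle n1; split=> //.
  apply: le_trans (root_alpha_le_capacity R G (r_gt0 n n1)).
  rewrite ler_root ?addr_ge0 ?exprn_ge0 //.
  by rewrite -natrX -[1]/(1%:R) -natrD ler_nat.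
exists 1 => //; near=> n; rewrite mul1r; apply/root_pow2_add1_ge/r_gt0.
by near: n; exact: nbhs_infty_ge.
Unshelve. all: by end_near.
Qed.
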